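(* The formula $$\left\lfloor n + \log_{\Phi}\left\{ \sqrt{5}\left( \log_{\Phi}(\sqrt{5}\, n) + n \right) - 5 + \frac{3}{n} \right\} - 2 \right\rfloor \qquad (n \geq 2)$$ ($n$ ranging over the integers $\geq 2$) generates the numbers which are not Fibonacci numbers; that is, the set of values of this expression over all integers $n \geq 2$ is equal to the set of nonnegative integers that are not of the form $F_k$ with $k \in \mathbb{N}$.
   Context: $\mathbb{N}$ denotes the set of nonnegative integers, $\lfloor \cdot \rfloor$ denotes the integer part (floor), $\Phi = \frac{1+\sqrt{5}}{2}$ is the golden ratio, and $\log_{\Phi}$ is the logarithm to base $\Phi$. The Fibonacci sequence $(F_n)_{n \in \mathbb{N}}$ is defined by $F_0 = 0$, $F_1 = 1$, and $F_{n+2} = F_n + F_{n+1}$ for all $n \in \mathbb{N}$; the Fibonacci numbers are the terms of this sequence. A formula (sequence) is said to generate a set if its set of values is equal to that set. *)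

(* Defs.v *)
From Stdlib Require Import Reals ZArith.
Open Scope R_scope.

Definition Phi : R := (1 + sqrt 5) / 2.

(* Not [ZArith.Zgcd_alt.fibonacci], whose indexing starts at 1, 1. *)
Fixpoint fib (n : nat) : nat :=
  match n with
  | O => O
  | S p => match p with
           | O => 1%nat
           | S q => (fib q + fib p)%nat
           end
  end.

Definition is_fib (m : nat) : Prop := exists k : nat, m = fib k.

(* The values are taken in [Z], where integer parts live; a set [A] of
   nonnegative integers is compared with them through its image in [Z], so
   that generating [A] includes that every value is nonnegative. *)
Definition generates_from (n0 : nat) (u : nat -> Z) (A : nat -> Prop) : Prop :=
  forall z : Z,
    (exists n : nat, (n0 <= n)%nat /\ u n = z) <->
    (exists m : nat, A m /\ z = Z.of_nat m).

(* Main.v *)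
Require Import Defs.
From Stdlib Require Import Reals ZArith.
From Stdlib Require Import Lra Lia.
Open Scope R_scope.

(** Write [G n] for the expression between braces ([braces] below), so that the
    formula is [floor (n + log_Phi (G n) - 2)].

    Exactly [k] nonnegative integers up to [F_k] are Fibonacci numbers when
    [k >= 2] (the value 1 occurs twice in the sequence).  Listing the
    non-Fibonacci numbers in increasing order from the index [n = 2], the
    [n]-th one is therefore [n - 2 + k], where [k] is determined by
    [F_k < n - 2 + k < F_(k+1)].  So the theorem amounts to
    [floor (log_Phi (G n)) = k], that is [Phi^k <= G n < Phi^(k+1)], on the
    block of integers [n] from [F_k - k + 3] to [F_(k+1) - k + 1].

    Since [G] is increasing ([braces_monotone]), only the two ends of a block
    matter: [Phi^k <= G (F_k - k + 3)] for [k >= 4] ([pow_Phi_le_braces]) and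
    [G (F_k - k + 2) < Phi^k] for [k >= 5] ([braces_lt_pow_Phi]).  Both come
    from Binet's formula [sqrt 5 * F_k = Phi^k - psi^k], with
    [psi = 1 - Phi].  For [n = F_k - k + i] the number [sqrt 5 * n] is
    slightly below [Phi^k], so its logarithm is [k - e] with a small [e >= 0],
    and
      [G n = sqrt 5 * (F_k + i - e) - 5 + 3 / n
           = Phi^k + (i * sqrt 5 - 5) - psi^k - sqrt 5 * e + 3 / n].
    The constant [i * sqrt 5 - 5] is about 1.7 for [i = 3] and about -0.5 for
    [i = 2], which decides the sign of [G n - Phi^k] as soon as the error
    terms are small; the finitely many remaining [k] are computed. *)

(** * Fibonacci numbers and the golden ratio *)

Lemma fib_SS (k : nat) : fib (S (S k)) = (fib k + fib (S k))%nat.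
Proof. reflexivity. Qed.

Lemma fib_monotone (k l : nat) : (k <= l)%nat -> (fib k <= fib l)%nat.
Proof.
  induction 1 as [|l _ IH]; [lia|].
  destruct l as [|l]; [simpl in *; lia|].
  rewrite fib_SS; lia.
Qed.

(** The slope 5 is what makes the error [sqrt 5 * e] of the introduction
    small enough for all [k >= 8]; equality holds at [k = 8]. *)
Lemma fib_linear_growth (k : nat) : (8 <= k)%nat -> (5 * k <= fib k + 19)%nat.
Proof.
  intros Hk.
  assert (H : (5 * k <= fib k + 19 /\ 5 <= fib (k - 1))%nat); [|tauto].
  induction Hk as [|k Hk [IH1 IH2]]; [vm_compute; lia|].
  destruct k as [|k]; [lia|].
  replace (S k - 1)%nat with k in IH2 by lia.
  replace (S (S k) - 1)%nat with (S k) by lia.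
  pose proof (fib_monotone k (S k)).
  rewrite fib_SS; lia.
Qed.

Lemma fib_gt_index (k : nat) : (7 <= k)%nat -> (k + 6 <= fib k)%nat.
Proof.
  intros Hk.
  destruct (Nat.eq_dec k 7) as [->|]; [vm_compute; lia|].
  pose proof (fib_linear_growth k); lia.
Qed.

Lemma fib_ge_index (k : nat) : (4 <= k)%nat -> (k <= fib k + 1)%nat.
Proof.
  intros Hk.
  destruct (Nat.le_gt_cases 7 k) as [H|H]; [pose proof (fib_gt_index k); lia|].
  assert (k = 4 \/ k = 5 \/ k = 6)%nat as [->|[->| ->]] by lia; vm_compute; lia.
Qed.

Lemma between_fib_not_fib (k m : nat) :
  (fib k < m < fib (S k))%nat -> ~ is_fib m.
Proof.
  intros [H1 H2] [l ->].
  destruct (Nat.le_gt_cases l k) as [H|H].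
  - pose proof (fib_monotone l k H); lia.
  - pose proof (fib_monotone (S k) l H); lia.
Qed.

Lemma sqrt5_sq : sqrt 5 * sqrt 5 = 5.
Proof. apply sqrt_sqrt; lra. Qed.

Lemma sqrt5_bounds : 2.236 < sqrt 5 < 2.2361.
Proof.
  pose proof sqrt5_sq; pose proof (sqrt_pos 5); split; nra.
Qed.

Lemma Phi_bounds : 1.618 < Phi < 1.61806.
Proof. unfold Phi; pose proof sqrt5_bounds; lra. Qed.

Lemma Phi_sq : Phi * Phi = Phi + 1.
Proof. unfold Phi; pose proof sqrt5_sq; nra. Qed.

Lemma pow_Phi_fib (k : nat) :
  Phi ^ S k = INR (fib (S k)) * Phi + INR (fib k).
Proof.
  induction k as [|k IH]; [simpl; ring|].
  change (Phi ^ S (S k)) with (Phi * Phi ^ S k).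
  rewrite IH, fib_SS, plus_INR.
  rewrite Rmult_plus_distr_l.
  replace (Phi * (INR (fib (S k)) * Phi)) with (INR (fib (S k)) * (Phi * Phi))
    by ring.
  rewrite Phi_sq; ring.
Qed.

Lemma binet (k : nat) : sqrt 5 * INR (fib k) = Phi ^ k - (1 - Phi) ^ k.
Proof.
  assert (H : sqrt 5 * INR (fib k) = Phi ^ k - (1 - Phi) ^ k /\
              sqrt 5 * INR (fib (S k)) = Phi ^ S k - (1 - Phi) ^ S k);
    [|tauto].
  induction k as [|k [IH1 IH2]].
  - unfold Phi; simpl; lra.
  - split; [exact IH2|].
    rewrite fib_SS, plus_INR, Rmult_plus_distr_l, IH1, IH2.
    pose proof Phi_sq as E; simpl.
    replace (Phi * (Phi * Phi ^ k)) with ((Phi * Phi) * Phi ^ k) by ring.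
    rewrite E.
    replace ((1 - Phi) * ((1 - Phi) * (1 - Phi) ^ k))
      with ((1 - 2 * Phi + Phi * Phi) * (1 - Phi) ^ k) by ring.
    rewrite E; ring.
Qed.

(** The powers of the conjugate [1 - Phi] of [Phi] are the error terms in
    Binet's formula; the bound is about the size of the seventh one. *)
Lemma pow_conj_small (k : nat) :
  (7 <= k)%nat -> - 0.036 <= (1 - Phi) ^ k <= 0.036.
Proof.
  intros Hk.
  pose proof Phi_bounds.
  enough (Habs : Rabs ((1 - Phi) ^ k) <= 0.036).
  { pose proof (Rle_abs ((1 - Phi) ^ k)).
    pose proof (Rle_abs (- (1 - Phi) ^ k)) as H'; rewrite Rabs_Ropp in H'.
    lra. }
  rewrite <- RPow_abs, Rabs_left by lra.
  apply Rle_trans with (0.62 ^ k); [apply pow_incr; lra|].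
  replace k with (7 + (k - 7))%nat by lia.
  rewrite pow_add.
  assert (0 < 0.62 ^ (k - 7)) by (apply pow_lt; lra).
  assert (0.62 ^ (k - 7) <= 1 ^ (k - 7)) as H1 by (apply pow_incr; lra).
  rewrite pow1 in H1; lra.
Qed.

(** * Logarithms to base [Phi] *)

Lemma ln_ge_one_minus_inv (y : R) : 0 < y -> 1 - / y <= ln y.
Proof.
  intros Hy.
  pose proof (exp_ineq1_le (- ln y)) as H.
  rewrite exp_Ropp, exp_ln in H by assumption.
  lra.
Qed.

Lemma ln_le_ln (x y : R) : 0 < x -> x <= y -> ln x <= ln y.
Proof.
  intros Hx [H| ->]; [|lra].
  left; apply ln_increasing; assumption.
Qed.

(** This is [ln Phi >= 1 - 1 / Phi], because [1 - 1 / Phi = 1 / Phi^2] and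
    [Phi^2 = Phi + 1].  The bound 0.38 for [ln Phi = 0.48...] is crude, but it
    is enough for [pow_Phi_le_braces_large]. *)
Lemma ln_Phi_ge : 1 <= (Phi + 1) * ln Phi.
Proof.
  pose proof Phi_bounds as B.
  assert (H : 1 - / Phi <= ln Phi) by (apply ln_ge_one_minus_inv; lra).
  assert (E : (Phi + 1) * (1 - / Phi) = 1).
  { field_simplify; [|lra].
    replace (Phi ^ 2) with (Phi + 1) by (rewrite <- Phi_sq; ring).
    field; lra. }
  nra.
Qed.

Lemma ln_Phi_pos : 0 < ln Phi.
Proof. pose proof ln_Phi_ge; pose proof Phi_bounds; nra. Qed.

(** Comparisons of [Rlog Phi] are reduced to comparisons of [ln] by cancelling
    the positive factor [ln Phi]. *)
Lemma ln_eq_Rlog (x : R) : ln x = Rlog Phi x * ln Phi.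
Proof. unfold Rlog; field; pose proof ln_Phi_pos; lra. Qed.

Lemma Rlog_Phi_le (x y : R) : 0 < x -> x <= y -> Rlog Phi x <= Rlog Phi y.
Proof.
  intros Hx Hxy.
  pose proof (ln_le_ln x y Hx Hxy) as H.
  rewrite (ln_eq_Rlog x), (ln_eq_Rlog y) in H.
  exact (Rmult_le_reg_r _ _ _ ln_Phi_pos H).
Qed.

Lemma Rlog_Phi_lt (x y : R) : 0 < x -> x < y -> Rlog Phi x < Rlog Phi y.
Proof.
  intros Hx Hxy.
  pose proof (ln_increasing x y Hx Hxy) as H.
  rewrite (ln_eq_Rlog x), (ln_eq_Rlog y) in H.
  exact (Rmult_lt_reg_r _ _ _ ln_Phi_pos H).
Qed.

Lemma Rlog_Phi_pow (k : nat) : Rlog Phi (Phi ^ k) = INR k.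
Proof. apply Rlog_pow; pose proof Phi_bounds; lra. Qed.

Lemma pow_Phi_pos (k : nat) : 0 < Phi ^ k.
Proof. apply pow_lt; pose proof Phi_bounds; lra. Qed.

(** Turns a lower bound [p / q] for a logarithm into an inequality between
    integer powers, which can be checked numerically. *)
Lemma Rlog_Phi_ge_rational (p q : nat) (x : R) :
  0 < x -> Phi ^ p <= x ^ q -> INR p <= INR q * Rlog Phi x.
Proof.
  intros Hx H.
  apply Rlog_Phi_le in H; [|apply pow_Phi_pos].
  rewrite Rlog_Phi_pow in H.
  unfold Rlog in *.
  rewrite ln_pow in H by assumption.
  lra.
Qed.

(** Controls the error [e] of the introduction: for [x] just below [Phi^k],
    [k - log_Phi x = ln (Phi^k / x) / ln Phi], where
    [ln (Phi^k / x) <= Phi^k / x - 1] and [1 / ln Phi <= Phi + 1]. *)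
Lemma Rlog_Phi_ge_below_pow (k : nat) (x : R) :
  0 < x -> x <= Phi ^ k ->
  INR k - (Phi + 1) * ((Phi ^ k - x) / x) <= Rlog Phi x.
Proof.
  intros Hx Hxk.
  pose proof (pow_Phi_pos k) as HP.
  pose proof ln_Phi_ge as HG; pose proof ln_Phi_pos as HL.
  assert (H : 1 - / (x / Phi ^ k) <= ln (x / Phi ^ k))
    by (apply ln_ge_one_minus_inv, Rdiv_lt_0_compat; assumption).
  unfold Rdiv in H at 2.
  rewrite ln_mult, ln_Rinv, (ln_eq_Rlog x), (ln_eq_Rlog (Phi ^ k)), Rlog_Phi_pow
    in H by auto using Rinv_0_lt_compat.
  replace (1 - / (x / Phi ^ k)) with (- ((Phi ^ k - x) / x)) in H
    by (field; lra).
  assert (Hd : 0 <= (Phi ^ k - x) / x).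
  { apply Rmult_le_pos; [lra|]. left; apply Rinv_0_lt_compat; assumption. }
  set (d := (Phi ^ k - x) / x) in *.
  apply Rmult_le_reg_r with (ln Phi); [exact HL|].
  nra.
Qed.

(** * The expression between braces *)

Definition braces (x : R) : R :=
  sqrt 5 * (Rlog Phi (sqrt 5 * x) + x) - 5 + 3 / x.

(** The linear term gains [sqrt 5 * (y - x)], while [3 / x] loses
    [3 * (y - x) / (x * y) <= y - x] because [x * y >= 4]. *)
Lemma braces_monotone (x y : R) : 2 <= x -> x <= y -> braces x <= braces y.
Proof.
  intros Hx Hxy.
  pose proof sqrt5_bounds as B.
  assert (HL : Rlog Phi (sqrt 5 * x) <= Rlog Phi (sqrt 5 * y))
    by (apply Rlog_Phi_le; nra).
  assert (HD : 3 / x - 3 / y <= y - x).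
  { replace (3 / x - 3 / y) with ((y - x) * (3 / (x * y))) by (field; lra).
    assert (3 / (x * y) <= 1) by (apply Rmult_le_reg_r with (x * y);
      [nra | replace (3 / (x * y) * (x * y)) with 3 by (field; lra); nra]).
    nra. }
  unfold braces; nra.
Qed.

Lemma pow_Phi_le_braces_small (k n p q : nat) :
  (0 < n)%nat ->
  (0 < q)%nat ->
  Phi ^ p <= (sqrt 5 * INR n) ^ q ->
  Phi ^ k <= sqrt 5 * (INR p / INR q + INR n) - 5 + 3 / INR n ->
  Phi ^ k <= braces (INR n).
Proof.
  intros Hn Hq H1 H2.
  apply lt_INR in Hn, Hq; simpl in Hn, Hq.
  pose proof sqrt5_bounds.
  apply Rlog_Phi_ge_rational in H1; [|nra].
  assert (INR p / INR q <= Rlog Phi (sqrt 5 * INR n)).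
  { apply Rmult_le_reg_l with (INR q); [assumption|].
    replace (INR q * (INR p / INR q)) with (INR p) by (field; lra).
    exact H1. }
  unfold braces; nra.
Qed.

(** Here [n = F_k - j] with [j = k - 3], and Binet's formula reads
    [Phi^k - sqrt 5 * n = sqrt 5 * j + psi^k].  The error [sqrt 5 * e] is then
    at most [(Phi + 1) * (sqrt 5 * j + psi^k) / n], so that after
    multiplication by [n] the claim becomes
    [(Phi + 1) * (sqrt 5 * j + psi^k) <= (3 * sqrt 5 - 5 - psi^k) * n + 3].
    It follows from [n >= 4 * j - 4] and [j >= 5]. *)
Lemma pow_Phi_le_braces_large (k n : nat) :
  (8 <= k)%nat -> (n + k = fib k + 3)%nat -> Phi ^ k <= braces (INR n).
Proof.
  intros Hk En.
  pose proof (fib_linear_growth k Hk) as HF.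
  pose proof (pow_conj_small k ltac:(lia)) as HC.
  pose proof (binet k) as HB.
  pose proof sqrt5_bounds as B; pose proof sqrt5_sq as S5.
  pose proof Phi_bounds as BP.
  assert (EF : INR (fib k) = INR n + (INR k - 3)).
  { apply (f_equal INR) in En; rewrite !plus_INR in En; simpl in En; lra. }
  assert (Hk' : 8 <= INR k) by (apply le_INR in Hk; simpl in Hk; lra).
  assert (Hn : 4 * (INR k - 3) - 4 <= INR n).
  { apply le_INR in HF; rewrite mult_INR, plus_INR in HF; simpl in HF; lra. }
  set (j := INR k - 3) in *.
  assert (Ek : INR k = j + 3) by (unfold j; ring).
  rewrite EF in HB.
  set (c := (1 - Phi) ^ k) in *.
  assert (EP : Phi ^ k = sqrt 5 * INR n + sqrt 5 * j + c) by lra.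
  pose proof (Rlog_Phi_ge_below_pow k (sqrt 5 * INR n)
                ltac:(nra) ltac:(nra)) as HL.
  set (L := Rlog Phi (sqrt 5 * INR n)) in *.
  rewrite EP, Ek in HL.
  replace ((sqrt 5 * INR n + sqrt 5 * j + c - sqrt 5 * INR n) / (sqrt 5 * INR n))
    with ((sqrt 5 * j + c) / (sqrt 5 * INR n)) in HL by (f_equal; ring).
  assert (HL' : sqrt 5 * (j + 3) - (Phi + 1) * ((sqrt 5 * j + c) / INR n)
                <= sqrt 5 * L).
  { replace ((sqrt 5 * j + c) / INR n)
      with (sqrt 5 * ((sqrt 5 * j + c) / (sqrt 5 * INR n))) by (field; lra).
    nra. }
  unfold braces; fold L.
  rewrite EP.
  enough (0 <= 3 * sqrt 5 - 5 - c + (3 - (Phi + 1) * (sqrt 5 * j + c)) / INR n)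
    by (unfold Rdiv in *; nra).
  apply Rmult_le_reg_r with (INR n); [lra|].
  rewrite Rmult_plus_distr_r.
  replace ((3 - (Phi + 1) * (sqrt 5 * j + c)) / INR n * INR n)
    with (3 - (Phi + 1) * (sqrt 5 * j + c)) by (field; lra).
  assert (1.672 * INR n <= (3 * sqrt 5 - 5 - c) * INR n) by nra.
  assert ((Phi + 1) * (sqrt 5 * j + c) <= 2.61806 * (2.2361 * j + 0.036))
    by (apply Rmult_le_compat; nra).
  lra.
Qed.

(** For [k < 8] the general estimate of the logarithm is too weak.  The
    logarithms of [sqrt 5 * n] for [n = 2, 3, 5, 9] are bounded below by
    [3], [15 / 4], [5] and [37 / 6] instead; [k = 5] is the
    tightest, with [Phi^5 = 11.090...] against the bound [11.093...] for
    [G 3]. *)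
Lemma pow_Phi_le_braces (k n : nat) :
  (4 <= k)%nat -> (n + k = fib k + 3)%nat -> Phi ^ k <= braces (INR n).
Proof.
  intros Hk En.
  destruct (Nat.le_gt_cases 8 k) as [H8|H8];
    [apply pow_Phi_le_braces_large; assumption|].
  pose proof sqrt5_bounds as B; pose proof Phi_bounds as BP.
  pose proof sqrt5_sq as S5.
  assert (k = 4 \/ k = 5 \/ k = 6 \/ k = 7)%nat as [->|[->|[->| ->]]] by lia.
  - assert (n = 2)%nat as -> by (simpl in En; lia).
    apply (pow_Phi_le_braces_small 4 2 3 1); try lia;
      rewrite !pow_Phi_fib; simpl; lra.
  - assert (n = 3)%nat as -> by (simpl in En; lia).
    apply (pow_Phi_le_braces_small 5 3 15 4); try lia.
    + replace ((sqrt 5 * INR 3) ^ 4) with (81 * (sqrt 5 * sqrt 5) ^ 2)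
        by (simpl; ring).
      rewrite S5, pow_Phi_fib, !INR_IZR_INZ; simpl; lra.
    + rewrite pow_Phi_fib, !INR_IZR_INZ; simpl; unfold Phi; lra.
  - assert (n = 5)%nat as -> by (simpl in En; lia).
    apply (pow_Phi_le_braces_small 6 5 5 1); try lia;
      rewrite !pow_Phi_fib; simpl; unfold Phi; lra.
  - assert (n = 9)%nat as -> by (simpl in En; lia).
    apply (pow_Phi_le_braces_small 7 9 37 6); try lia.
    + replace ((sqrt 5 * INR 9) ^ 6) with (531441 * (sqrt 5 * sqrt 5) ^ 3)
        by (simpl; ring).
      (* Splitting the power keeps the Fibonacci numbers, which are unary,
         small: [Phi ^ 12 = 144 * Phi + 89 = 321.99...]. *)
      replace (Phi ^ 37) with ((Phi ^ 12) ^ 3 * Phi) by ring.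
      assert (H12 : Phi ^ 12 <= 323)
        by (rewrite pow_Phi_fib, !INR_IZR_INZ; simpl; lra).
      pose proof (pow_Phi_pos 12).
      pose proof (pow_incr (Phi ^ 12) 323 3 ltac:(lra)).
      rewrite S5; nra.
    + rewrite pow_Phi_fib, !INR_IZR_INZ; simpl; unfold Phi; lra.
Qed.

(** For [k >= 7] it suffices that [sqrt 5 * n <= Phi^k], so that the logarithm
    is at most [k]: the rest [2 * sqrt 5 - 5 - psi^k + 3 / n] is negative as
    [n >= 8].  For [k = 5, 6], where [3 / n] exceeds [5 - 2 * sqrt 5], the
    logarithm is even at most [k - 1]. *)
Lemma braces_lt_pow_Phi (k n : nat) :
  (5 <= k)%nat -> (n + k = fib k + 2)%nat -> braces (INR n) < Phi ^ k.
Proof.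
  intros Hk En.
  pose proof sqrt5_bounds as B; pose proof Phi_bounds as BP.
  assert (Hlog : forall l : nat, (0 < n)%nat -> sqrt 5 * INR n <= Phi ^ l ->
            Rlog Phi (sqrt 5 * INR n) <= INR l).
  { intros l Hn H. rewrite <- (Rlog_Phi_pow l).
    apply lt_INR in Hn; simpl in Hn.
    apply Rlog_Phi_le; [nra|exact H]. }
  destruct (Nat.le_gt_cases 7 k) as [H7|H7].
  - pose proof (fib_gt_index k H7) as HF.
    pose proof (pow_conj_small k H7) as HC.
    pose proof (binet k) as HB.
    assert (Hn : 8 <= INR n)
      by (assert (8 <= n)%nat as H by lia; apply le_INR in H; simpl in H; lra).
    assert (Hk' : 7 <= INR k) by (apply le_INR in H7; simpl in H7; lra).
    assert (EF : INR (fib k) = INR n + INR k - 2).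
    { apply (f_equal INR) in En; rewrite !plus_INR in En; simpl in En; lra. }
    rewrite EF in HB.
    assert (Rlog Phi (sqrt 5 * INR n) <= INR k)
      by (apply Hlog; [lia | nra]).
    assert (3 / INR n <= 0.375).
    { apply Rmult_le_reg_r with (INR n); [lra|].
      replace (3 / INR n * INR n) with 3 by (field; lra). lra. }
    assert (sqrt 5 * (Rlog Phi (sqrt 5 * INR n) + INR n)
            <= sqrt 5 * (INR k + INR n)) by (apply Rmult_le_compat_l; lra).
    unfold braces; lra.
  - assert (k = 5 \/ k = 6)%nat as [->| ->] by lia.
    + assert (n = 2)%nat as -> by (simpl in En; lia).
      assert (Rlog Phi (sqrt 5 * INR 2) <= INR 4)
        by (apply Hlog; [lia | rewrite pow_Phi_fib; simpl; lra]).
      unfold braces; rewrite pow_Phi_fib; simpl in *; nra.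
    + assert (n = 4)%nat as -> by (simpl in En; lia).
      assert (Rlog Phi (sqrt 5 * INR 4) <= INR 5)
        by (apply Hlog; [lia | rewrite pow_Phi_fib; simpl; lra]).
      unfold braces; rewrite pow_Phi_fib; simpl in *; nra.
Qed.

(** * The value of the formula *)

(** The hypotheses place [n] in the block of [k].  Its two ends
    [F_k + 3 - k] and [F_(k+1) + 2 - (k + 1)] have the shapes treated by
    [pow_Phi_le_braces] and, for [k + 1], by [braces_lt_pow_Phi]. *)
Lemma formula_value (k n : nat) :
  (4 <= k)%nat -> (2 <= n)%nat ->
  (fib k + 3 <= n + k)%nat -> (n + k <= fib (S k) + 1)%nat ->
  Int_part (INR n + Rlog Phi (braces (INR n)) - 2) = Z.of_nat (n - 2 + k).
Proof.
  intros Hk Hn Hlo Hhi.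
  pose proof (fib_ge_index k Hk) as HF.
  assert (Ha : Phi ^ k <= braces (INR n)).
  { apply Rle_trans with (braces (INR (fib k + 3 - k))).
    - apply pow_Phi_le_braces; lia.
    - apply braces_monotone; [apply (le_INR 2) | apply le_INR]; lia. }
  assert (Hb : braces (INR n) < Phi ^ S k).
  { apply Rle_lt_trans with (braces (INR (fib (S k) + 2 - S k))).
    - apply braces_monotone; [apply (le_INR 2) | apply le_INR]; lia.
    - apply braces_lt_pow_Phi; lia. }
  pose proof (pow_Phi_pos k) as HP.
  apply Rlog_Phi_lt in Hb; [|lra].
  apply Rlog_Phi_le in Ha; [|exact HP].
  rewrite Rlog_Phi_pow in Ha, Hb; rewrite S_INR in Hb.
  symmetry; apply Int_part_spec.
  rewrite <- INR_IZR_INZ, plus_INR, minus_INR by exact Hn.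
  simpl; lra.
Qed.

(** Finds the block of a given [n], and the two consecutive Fibonacci numbers
    around a given [m]. *)
Lemma exists_crossing (f : nat -> nat) (x k0 N : nat) :
  (f k0 <= x)%nat -> (k0 <= N)%nat -> (x < f N)%nat ->
  exists k, (k0 <= k)%nat /\ (f k <= x < f (S k))%nat.
Proof.
  intros H0 HN HxN.
  induction HN as [|N HN IH]; [lia|].
  destruct (Nat.le_gt_cases (f N) x) as [H|H].
  - exists N; lia.
  - exact (IH H).
Qed.

Theorem corollary2p3 :
  generates_from 2
    (fun n : nat =>
       Int_part (INR n
                 + Rlog Phi (sqrt 5 * (Rlog Phi (sqrt 5 * INR n) + INR n)
                             - 5 + 3 / INR n)
                 - 2))
    (fun m : nat => ~ is_fib m).
Proof.
  intros z; split.
  - intros [n [Hn <-]].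
    (* [F_k + 3 - k] is where the block of [k] starts; it is 2 for [k = 4] and
       exceeds [n] for [k = n + 8]. *)
    destruct (exists_crossing (fun k => fib k + 3 - k)%nat n 4 (n + 8))
      as [k [Hk [Hlo Hhi]]].
    + simpl; lia.
    + lia.
    + pose proof (fib_linear_growth (n + 8)); lia.
    + pose proof (fib_ge_index k Hk).
      pose proof (fib_ge_index (S k)).
      exists (n - 2 + k)%nat; split.
      * apply (between_fib_not_fib k); lia.
      * apply (formula_value k n); lia.
  - intros [m [Hm ->]].
    assert (Hm4 : (4 <= m)%nat).
    { destruct (Nat.le_gt_cases 4 m) as [H|H]; [exact H|exfalso; apply Hm].
      assert (m = 0 \/ m = 1 \/ m = 2 \/ m = 3)%nat as [->|[->|[->| ->]]] by lia;
        [exists 0%nat | exists 1%nat | exists 3%nat | exists 4%nat]; reflexivity. }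
    destruct (exists_crossing fib m 4 (m + 7)) as [k [Hk [Hlo Hhi]]].
    + simpl; lia.
    + lia.
    + pose proof (fib_gt_index (m + 7)); lia.
    + assert (fib k <> m) by (intros <-; apply Hm; exists k; reflexivity).
      pose proof (fib_ge_index k Hk).
      exists (m + 2 - k)%nat; split; [lia|].
      transitivity (Z.of_nat (m + 2 - k - 2 + k)); [|f_equal; lia].
      apply formula_value; lia.
Qed.
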